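(* Let $\delta=\delta(n)$ be a deletion rate with $\delta(n)\cdot n\to\infty$ as $n\to\infty$. There is an absolute constant $c>0$ such that for sufficiently large $n$, $L_{1,\mathrm{avg}}(\delta,n)\le\big(1-c\,\delta/\log(1/\delta)\big)n$.
   Context: For $x\in\{0,1\}^n$ and $0<\delta<1$, the deletion channel $\mathrm{Del}_\delta(x)$ is the distribution over $\{0,1\}^{\le n}$ obtained by independently deleting each bit of $x$ with probability $\delta$ and concatenating the surviving bits; a draw is a trace of $x$. $|\mathsf{LCS}(u,v)|$ denotes the length of a longest common subsequence of $u,v$. Define $L_{1,\mathrm{avg}}(\delta,n):=\max_A\mathbb{E}_{x\sim\{0,1\}^n}\mathbb{E}_{y\sim\mathrm{Del}_\delta(x)}[|\mathsf{LCS}(A(y,n),x)|]$, with $x$ uniform and the maximum over all algorithms $A$ that receive $n,\delta$ and a single trace $y$ and output an $n$-bit string. $\log$ is base 2.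
   Formalization: The claim is false when δ(n) approaches 1 (e.g. δ=1−1/n makes the right side negative), so it is assumed that δ(n) ≤ d0 for all large n, for an arbitrary fixed d0 < 1; the constant c depends only on d0. *)

(* Defs.v *)
From HB Require Import structures.
From mathcomp Require Import all_boot all_order all_algebra.
From mathcomp Require Import all_classical all_reals all_analysis.

Set Implicit Arguments.
Unset Strict Implicit.
Unset Printing Implicit Defensive.

Import Order.TTheory GRing.Theory Num.Theory.
Import numFieldNormedType.Exports.

Local Open Scope ring_scope.

Section LCS.
Variable T : finType.
Implicit Types u v w : seq T.

Definition lcs u v : nat :=
  (\max_(w : (size u).-bseq T | subseq w u && subseq w v) size w)%N.

Lemma leq_lcs u v w : subseq w u -> subseq w v -> (size w <= lcs u v)%N.
Proof.
move=> wu wv.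
rewrite /lcs.
by apply: (bigop.bigmax_sup (Bseq (size_subseq wu))); rewrite //= wu wv.
Qed.

Lemma lcs_attained u v :
  exists w, [/\ subseq w u, subseq w v & size w = lcs u v].
Proof.
rewrite /lcs (bigop.bigmax_eq_arg [bseq]) ?sub0seq//.
case: arg_maxnP => [|w]; rewrite ?sub0seq//= => /andP[wu wv] _.
by exists w.
Qed.

End LCS.

Section DeletionChannel.
Variables (R : realType) (d : R) (n : nat).
Implicit Types (x : n.-tuple bool) (y : n.-bseq bool).

(* [tnth s i] is [true] when bit [i] survives. *)
Definition survival_prob (s : n.-tuple bool) : R :=
  \prod_(i < n) (if tnth s i then 1 - d else d).

Lemma size_trace (s x : n.-tuple bool) : (size (mask s x) <= n)%N.
Proof. by rewrite -[leqRHS](size_tuple x) size_subseq// mask_subseq. Qed.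

Definition trace (s x : n.-tuple bool) : n.-bseq bool := Bseq (size_trace s x).

Definition Del x y : R := \sum_(s | trace s x == y) survival_prob s.

Lemma Del_ge0 x y : 0 <= d <= 1 -> 0 <= Del x y.
Proof.
move=> /andP[d0 d1]; apply: sumr_ge0 => s _; apply: prodr_ge0 => i _.
by case: ifP => _ //; rewrite subr_ge0.
Qed.

Lemma Del_sum1 x : \sum_y Del x y = 1.
Proof.
have -> : \sum_y Del x y = \sum_s survival_prob s.
  by rewrite (partition_big (fun s => trace s x) predT).
rewrite /survival_prob.
pose F (_ : 'I_n) b : R := if b then 1 - d else d.
transitivity (\prod_(i < n) \sum_b F i b); last first.
  by rewrite big1// => i _; rewrite big_bool /F /= subrK.
rewrite bigA_distr_bigA/=.
rewrite (reindex (fun s : n.-tuple bool => [ffun i => tnth s i]))/=; last first.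
  exists (fun f : {ffun 'I_n -> bool} => [tuple f i | i < n]) => [s _|f _].
    by apply: eq_from_tnth => i; rewrite tnth_mktuple ffunE.
  by apply/ffunP => i; rewrite ffunE tnth_mktuple.
by apply: eq_bigr => s _; apply: eq_bigr => i _; rewrite ffunE.
Qed.

Definition expected_lcs (A : n.-bseq bool -> n.-tuple bool) : R :=
  (2 ^+ n)^-1 * \sum_x \sum_y Del x y * (lcs (A y) x)%:R.

End DeletionChannel.

(* For fixed [n] and [d], an algorithm is a function from possible traces to
   [n]-bit strings; there are finitely many. As all expectations are
   nonnegative for [0 <= d <= 1], the default [0] of the iterated maximum is
   harmless. *)
Definition L1avg (R : realType) (d : R) (n : nat) : R :=
  \big[Num.max/0]_(A : {ffun n.-bseq bool -> n.-tuple bool}) expected_lcs d A.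

Lemma expected_lcs_ge0 (R : realType) (d : R) n A :
  0 <= d <= 1 -> 0 <= expected_lcs (n := n) d A.
Proof.
move=> d01; rewrite /expected_lcs mulr_ge0 ?invr_ge0 ?exprn_ge0//.
by apply: sumr_ge0 => x _; apply: sumr_ge0 => y _; rewrite mulr_ge0 ?Del_ge0.
Qed.

Lemma expected_lcs_le_L1avg (R : realType) (d : R) n A :
  expected_lcs (n := n) d A <= L1avg d n.
Proof.
rewrite /L1avg; pose B := [ffun y => A y].
have -> : expected_lcs d A = expected_lcs d B.
  congr (_ * _); apply: eq_bigr => x _; apply: eq_bigr => y _.
  by rewrite ffunE.
exact: (le_bigmax _ (fun B : {ffun _ -> _} => expected_lcs d B)).
Qed.

Lemma L1avg_attained (R : realType) (d : R) n :
  0 <= d <= 1 -> exists A, expected_lcs (n := n) d A = L1avg d n.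
Proof.
move=> d01; rewrite /L1avg.
pose A0 : {ffun n.-bseq bool -> n.-tuple bool} :=
  [ffun=> [tuple of nseq n false]].
rewrite (bigmax_eq_arg _ A0)//; last by move=> A _; exact: expected_lcs_ge0.
by eexists.
Qed.

Definition log2 (R : realType) (a : R) : R := ln a / ln 2.

(* Main.v *)
(** Fix the survival mask s of the deletion channel.  The trace then takes at
    most 2^|s| values, and each output z of the algorithm has
    LCS(z, x) >= n - k for at most C(n,k)^2 2^k strings x.  So for uniform x
    the event LCS >= n - k has probability at most
    2^-(number of deletions) C(n,k)^2 2^k.  Averaging over s gives
    (1 - d/2)^n C(n,k)^2 2^k, because the deletions are independent, and this
    is at most 1/2 when k is at most a small multiple of d n / log(1/d) and
    d n >= 8. *)
Require Import Defs.
From mathcomp Require Import all_boot all_order all_algebra.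
From mathcomp Require Import all_classical all_reals all_analysis.
From mathcomp Require Import ring lra.
Import Order.TTheory GRing.Theory Num.Theory.
Import numFieldNormedType.Exports.
Local Open Scope classical_set_scope.
Local Open Scope ring_scope.

(** * Product weights on bit strings *)

Lemma sum_prod_bool_tuple {R : comNzRingType} {n} (a b : R) :
  \sum_(s : n.-tuple bool) \prod_(i < n) (if tnth s i then a else b)
  = (a + b) ^+ n.
Proof.
pose F (_ : 'I_n) (c : bool) : R := if c then a else b.
transitivity (\prod_(i < n) \sum_c F i c); last first.
  under eq_bigr do rewrite big_bool.
  by rewrite /F prodr_const card_ord.
rewrite bigA_distr_bigA /= (reindex (@finfun_of_tuple bool n)); last first.
  by exists (@tuple_of_finfun bool n) => ? _;
    rewrite ?finfun_of_tupleK ?tuple_of_finfunK.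
by apply: eq_bigr => s _; apply: eq_bigr => i _; rewrite ffunE.
Qed.

Lemma prod_bool_seq {R : comNzRingType} (a b : R) (s : seq bool) :
  \prod_(c <- s) (if c then a else b) = a ^+ count id s * b ^+ count negb s.
Proof.
elim: s => [|c s IHs]; first by rewrite big_nil mulr1.
by rewrite big_cons IHs; case: c => /=; rewrite add0n add1n exprS; ring.
Qed.

Lemma prod_bool_tuple {R : comNzRingType} {n} (a b : R) (s : n.-tuple bool) :
  \prod_(i < n) (if tnth s i then a else b)
  = a ^+ count id s * b ^+ count negb s.
Proof. by rewrite -prod_bool_seq big_tuple. Qed.

Lemma count_id_negb {n} (s : n.-tuple bool) : (count id s + count negb s)%N = n.
Proof. by rewrite -[RHS](size_tuple s) -(count_predC id). Qed.

Lemma count_negbE {n} (s : n.-tuple bool) : count negb s = (n - count id s)%N.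
Proof. by rewrite -[X in (X - _)%N](count_id_negb s) addKn. Qed.

(** * Masks, their complements and counting *)

Lemma mask_negb_inj (T : Type) (m : seq bool) (x y : seq T) :
  size x = size m -> size y = size m ->
  mask m x = mask m y -> mask (map negb m) x = mask (map negb m) y -> x = y.
Proof.
elim: m x y => [|b m IHm] [|a x] [|c y] //= [sx] [sy].
by case: b => /= [[-> e1 e2]|e1 [-> e2]]; rewrite (IHm x y).
Qed.

(** Recording the length places the kept bits in a finite type of known cardinality. The definition
    is transparent so that [val] reduces to [mask m x]. *)
Definition mask_tuple {T : Type} {n} (m : n.-tuple bool) (x : n.-tuple T) :
  (count id m).-tuple T.
Proof.
by apply: (@Tuple _ _ (mask m x)); rewrite size_mask// !size_tuple.
Defined.

Lemma count_id_map_negb (s : seq bool) :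
  count id (map negb s) = count negb s.
Proof. by rewrite count_map; apply: eq_count. Qed.

(** With [mask m x] fixed, [x] is determined by its bits at the positions that [m] drops. *)
Lemma card_mask_fiber {n} (m : n.-tuple bool) (w : seq bool) :
  (#|[set x : n.-tuple bool | mask m x == w]%SET| <= 2 ^ count negb m)%N.
Proof.
pose f (x : n.-tuple bool) := mask_tuple (map_tuple negb m) x.
rewrite -(@card_in_imset _ _ f).
  apply: leq_trans (max_card _) _.
  by rewrite card_tuple card_bool count_id_map_negb.
move=> x y; rewrite !inE => /eqP ex /eqP ey /(congr1 val)/= exy.
apply: val_inj; apply: (mask_negb_inj _ m) => //=; rewrite ?size_tuple//.
by rewrite ex ey.
Qed.

Definition masks n j : {set n.-tuple bool} :=
  [set m : n.-tuple bool | count id m == j]%SET.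

Lemma subseq_mask_tuple {n} {w : seq bool} {x : n.-tuple bool} :
  subseq w x ->
  exists2 m : n.-tuple bool, m \in masks n (size w) & w = mask m x.
Proof.
case/subseqP => m sm ->; have sm' : size m == n by rewrite sm size_tuple.
by exists (Tuple sm'); rewrite // inE /= size_mask.
Qed.

Lemma card_cover_le (I T : finType) (A : {set T}) (B : {set I})
    (E : I -> {set T}) b :
  (forall x, x \in A -> exists2 i, i \in B & x \in E i) ->
  (forall i, i \in B -> #|E i| <= b)%N -> (#|A| <= #|B| * b)%N.
Proof.
move=> AE Eb; pose U := finset.cover (E @: B)%SET.
have AU : A \subset U.
  by apply/fintype.subsetP => x /AE [i iB xi]; apply/finset.bigcupP;
    exists (E i) => //; exact: imset_f.
apply: leq_trans (subset_leq_card AU) _.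
apply: leq_trans (finset.leq_card_cover _) _.
apply: (@leq_trans (\sum_(F in (E @: B)%SET) b)%N).
  by apply: leq_sum => _ /imsetP[i iB ->]; exact: Eb.
(* Distinct indices may give the same set, so the cover has at most [#|B|] members. *)
by rewrite sum_nat_const leq_mul2r leq_imset_card orbT.
Qed.

(** * Counting strings with a large LCS *)

Definition lcs_ball {n} (z : n.-tuple bool) j : {set n.-tuple bool} :=
  [set x : n.-tuple bool | (j <= lcs z x)%N]%SET.

(** Two masks locate a common subsequence of length [j] in [z] and in [x]. Once both are fixed, [z]
    dictates [j] bits of [x] and the other [n - j] are free. *)
Lemma card_lcs_ball {n} (z : n.-tuple bool) j :
  (#|lcs_ball z j| <= #|masks n j| ^ 2 * 2 ^ (n - j))%N.
Proof.
pose E (p : n.-tuple bool * n.-tuple bool) :=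
  [set x : n.-tuple bool | mask p.2 x == mask p.1 z]%SET.
rewrite expnS expn1 -cardsX.
apply: (@card_cover_le _ _ _ _ E) => [x|[m1 m2]].
  rewrite inE => jx; have [w [wz wx sw]] := lcs_attained z x.
  (* A longest common subsequence may exceed [j]; its prefix of length exactly [j] is still
     common. *)
  have sj : size (take j w) = j by rewrite size_takel // sw.
  have tw : subseq (take j w) w by apply: take_subseq.
  have [m1 m1j e1] := subseq_mask_tuple (subseq_trans tw wz).
  have [m2 m2j e2] := subseq_mask_tuple (subseq_trans tw wx).
  rewrite sj in m1j m2j.
  exists (m1, m2); first by rewrite finset.in_setX m1j m2j.
  by rewrite inE /= -e1 -e2.
rewrite finset.in_setX !inE /= => /andP[_ /eqP m2j].
by rewrite -m2j -count_negbE card_mask_fiber.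
Qed.

(** For fixed [s], strings with equal traces share one output of [A], so each trace value
    contributes at most one LCS ball. *)
Lemma card_lcs_trace {n} (A : n.-bseq bool -> n.-tuple bool)
    (s : n.-tuple bool) j :
  (#|[set x : n.-tuple bool | (j <= lcs (A (trace s x)) x)%N]%SET|
   <= 2 ^ count id s * (#|masks n j| ^ 2 * 2 ^ (n - j)))%N.
Proof.
set b := (#|masks n j| ^ 2 * _)%N.
pose E (y : (count id s).-tuple bool) := [set x : n.-tuple bool |
  (mask_tuple s x == y) && (j <= lcs (A (trace s x)) x)%N]%SET.
have -> : (2 ^ count id s)%N = #|[set: (count id s).-tuple bool]%SET|.
  by rewrite cardsT card_tuple card_bool.
apply: (@card_cover_le _ _ _ _ E) => [x|y _].
  by rewrite inE => jx; exists (mask_tuple s x); rewrite ?inE ?eqxx.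
(* Any member [x0] of a nonempty fiber gives the center of the ball that contains the whole
   fiber. *)
have [->|[x0]] := set_0Vmem (E y); first by rewrite cards0.
rewrite inE => /andP[/eqP <- _].
apply: leq_trans (card_lcs_ball (A (trace s x0)) j).
apply/subset_leq_card/fintype.subsetP => x; rewrite !inE => /andP[/eqP e].
suff -> : trace s x = trace s x0 by [].
by apply: val_inj; rewrite /= -[LHS]/(val (mask_tuple s x)) e.
Qed.

(** * Averaging over the survival mask *)

Section Expectation.
Context {R : realType}.
Implicit Types (d l : R).

Lemma survival_probE d n (s : n.-tuple bool) :
  survival_prob d s = (1 - d) ^+ count id s * d ^+ count negb s.
Proof. exact: prod_bool_tuple. Qed.

Lemma survival_prob_ge0 d n (s : n.-tuple bool) :
  0 <= d <= 1 -> 0 <= survival_prob d s.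
Proof.
by move=> /andP[d0 d1]; rewrite survival_probE mulr_ge0// exprn_ge0// subr_ge0.
Qed.

Lemma sum_survival_prob d n : \sum_(s : n.-tuple bool) survival_prob d s = 1.
Proof. by rewrite sum_prod_bool_tuple subrK expr1n. Qed.

(* A Chernoff-type bound on the binomial coefficient C(n,k): each of these masks
   has probability at least l^k (1 - l)^n under independent deletions of
   rate l. *)
Lemma card_masks_le l n k : 0 < l < 1 ->
  #|masks n (n - k)%N|%:R * (l ^+ k * (1 - l) ^+ n) <= 1.
Proof.
move=> /andP[l0 l1]; rewrite -[leRHS](sum_survival_prob l n).
rewrite mulr_natl -sumr_const [leRHS](bigID (mem (masks n (n - k)%N))) /=.
rewrite -[leLHS]addr0 lerD//; last first.
  by apply: sumr_ge0 => s _; apply: survival_prob_ge0; rewrite !ltW.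
apply: ler_sum => s; rewrite inE => /eqP sk.
rewrite survival_probE mulrC.
have sn := count_id_negb s.
apply: ler_pM.
- by rewrite exprn_ge0// subr_ge0 ltW.
- by rewrite exprn_ge0// ltW.
- apply: ler_wiXn2l; rewrite ?subr_ge0 ?gerBl ?(ltW l0) ?(ltW l1)//.
  by rewrite -[leqRHS]sn leq_addr.
(* The number of deletions is [n - (n - k)], which is [k] unless [k > n], where truncation makes it
   [n]. *)
- apply: ler_wiXn2l; rewrite ?(ltW l0) ?(ltW l1)//.
  by rewrite count_negbE sk leq_subLR addnC -leq_subLR.
Qed.

(** Each deleted bit contributes a factor 1/2, so by independence every position contributes (1 - d)
    + d/2. *)
Lemma sum_survival_prob_half d n :
  \sum_(s : n.-tuple bool) survival_prob d s * (2 ^+ n)^-1 * 2 ^+ count id s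
  = (1 - d / 2) ^+ n.
Proof.
have -> : 1 - d / 2 = (1 - d) + d / 2 by field.
rewrite -(sum_prod_bool_tuple (1 - d)); apply: eq_bigr => s _.
rewrite prod_bool_tuple survival_probE expr_div_n.
have -> : (2 : R) ^+ n = 2 ^+ count id s * 2 ^+ count negb s.
  by rewrite -exprD count_id_negb.
have two0 m : 2 ^+ m != 0 :> R by rewrite expf_neq0// pnatr_eq0.
by field; rewrite !two0.
Qed.

(** Moves the randomness from the trace to the mask, so that [s] can be fixed before averaging over
    [x]. *)
Lemma expected_lcsE d n A :
  expected_lcs (n := n) d A =
  \sum_s survival_prob d s * (2 ^+ n)^-1 *
    \sum_(x : n.-tuple bool) (lcs (A (trace s x)) x)%:R.
Proof.
rewrite /expected_lcs.
under eq_bigr => x _.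
  have -> : \sum_y Del d x y * (lcs (A y) x)%:R =
    \sum_s survival_prob d s * (lcs (A (trace s x)) x)%:R.
    rewrite [RHS](partition_big (fun s => trace s x) predT) //=.
    apply: eq_bigr => y _; rewrite mulr_suml.
    by apply: eq_bigr => s /eqP ->.
  over.
rewrite exchange_big /= mulr_sumr; apply: eq_bigr => s _.
by rewrite -mulr_sumr mulrA [_^-1 * _]mulrC.
Qed.

(** The count for fixed [s] depends on [s] only through [2 ^ count id s], and [card_masks_le] bounds
    both mask counts. The rate [l] stays free for later tuning. *)
Lemma lcs_trace_tail {d l n} k (A : n.-bseq bool -> n.-tuple bool) :
  0 <= d <= 1 -> 0 < l < 1 ->
  \sum_(s : n.-tuple bool) survival_prob d s * (2 ^+ n)^-1 *
    #|[set x : n.-tuple bool | (n - k <= lcs (A (trace s x)) x)%N]%SET|%:R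
  <= (1 - d / 2) ^+ n * (2 / l ^+ 2) ^+ k / (1 - l) ^+ (2 * n).
Proof.
move=> d01 l01; have /andP[l0 l1] := l01.
have l1' : 0 < 1 - l by rewrite subr_gt0.
pose M : R := #|masks n (n - k)%N|%:R.
have M0 : 0 <= M by [].
have Ml : M <= (l ^+ k * (1 - l) ^+ n)^-1.
  by rewrite -[leRHS]mul1r ler_pdivlMr ?mulr_gt0 ?exprn_gt0// card_masks_le.
apply: (@le_trans _ _ (\sum_(s : n.-tuple bool)
    survival_prob d s * (2 ^+ n)^-1 * 2 ^+ count id s * (M ^+ 2 * 2 ^+ k))).
  apply: ler_sum => s _; rewrite -!mulrA ler_wpM2l ?survival_prob_ge0//.
  rewrite ler_wpM2l ?invr_ge0 ?exprn_ge0// /M -!natrX -!natrM ler_nat.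
  apply: leq_trans (card_lcs_trace _ _ _) _; rewrite -mulnn -!mulnA.
  by rewrite !leq_mul2l leq_exp2l// leq_subLR addnC -leq_subLR leqnn !orbT.
rewrite -mulr_suml sum_survival_prob_half -mulrA.
rewrite ler_wpM2l ?exprn_ge0//; first by lra.
have -> : (2 / l ^+ 2) ^+ k / (1 - l) ^+ (2 * n)
    = ((l ^+ k * (1 - l) ^+ n)^-1) ^+ 2 * 2 ^+ k.
  rewrite expr_div_n -exprM mulnC [(2 * n)%N]mulnC !exprM.
  by field; rewrite !expf_neq0// gt_eqF.
by rewrite ler_wpM2r ?exprn_ge0// lerXn2r// nnegrE (le_trans M0).
Qed.

(** * From the tail bound to the expectation, and numerical estimates *)

Lemma leq_lcs_size n (z x : n.-tuple bool) : (lcs z x <= n)%N.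
Proof.
have [w [wz _ <-]] := lcs_attained z x.
by rewrite -[leqRHS](size_tuple z) size_subseq.
Qed.

(* Rounding t down loses nothing: an LCS below n - k misses n by at least
   k + 1 > t.  This matters when t < 1, where k = 0. *)
Lemma expected_lcs_le {d n} {A : n.-bseq bool -> n.-tuple bool} {t p : R} :
  0 <= d <= 1 -> 0 <= t ->
  \sum_(s : n.-tuple bool) survival_prob d s * (2 ^+ n)^-1 *
    #|[set x : n.-tuple bool |
        (n - Num.truncn t <= lcs (A (trace s x)) x)%N]%SET|%:R
  <= p ->
  expected_lcs (n := n) d A <= n%:R - t + t * p.
Proof.
move=> d01 t0 tailp; set k := Num.truncn t.
have lcs_le (z x : n.-tuple bool) :
    (lcs z x)%:R <= n%:R - t + t * (n - k <= lcs z x)%N%:R :> R.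
  case: leqP => [_|lt_lcs] /=.
    by rewrite mulr1 subrK ler_nat leq_lcs_size.
  have : (lcs z x)%:R + k.+1%:R <= n%:R :> R.
    by rewrite -natrD ler_nat addnS addnC -ltn_subRL.
  have := truncnS_gt t; rewrite -/k; lra.
have sum_const (a : R) : \sum_(x : n.-tuple bool) a = a * 2 ^+ n.
  by rewrite sumr_const -[LHS]mulr_natr card_tuple card_bool natrX.
have sum_ind (b : pred (n.-tuple bool)) :
    \sum_(x : n.-tuple bool) (b x)%:R = #|[set x | b x]%SET|%:R :> R.
  rewrite -sum1_card natr_sum [RHS]big_mkcond /=.
  by apply: eq_bigr => x _; rewrite inE; case: (b x).
rewrite expected_lcsE; apply: (@le_trans _ _ (\sum_(s : n.-tuple bool)
    (survival_prob d s * (n%:R - t) + t * (survival_prob d s * (2 ^+ n)^-1 *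
    #|[set x : n.-tuple bool | (n - k <= lcs (A (trace s x)) x)%N]%SET|%:R)))).
  apply: ler_sum => s _.
  apply: (@le_trans _ _ (survival_prob d s * (2 ^+ n)^-1 *
      \sum_(x : n.-tuple bool)
        (n%:R - t + t * (n - k <= lcs (A (trace s x)) x)%N%:R))).
    rewrite ler_wpM2l ?mulr_ge0 ?survival_prob_ge0 ?invr_ge0 ?exprn_ge0//.
    exact: ler_sum.
  rewrite big_split /= sum_const -mulr_sumr sum_ind.
  have two0 : 2 ^+ n != 0 :> R by rewrite expf_neq0// pnatr_eq0.
  have -> (a b : R) : survival_prob d s / 2 ^+ n * (a * 2 ^+ n + t * b)
    = survival_prob d s * a + t * (survival_prob d s / 2 ^+ n * b).
    by field.
  by [].
rewrite big_split /= -mulr_suml sum_survival_prob mul1r -mulr_sumr.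
by rewrite lerD2l ler_wpM2l.
Qed.

(** The three factors are at most exp(-dn/2), exp(dn/8) and exp(dn/4), so the product is at most
    exp(-dn/8) <= 1/e. The rate d/16 is small enough for the last factor to leave this margin. *)
Lemma tail_le_half d n k : 0 < d < 1 -> 8 <= d * n%:R ->
  k%:R * ln (2 ^+ 9 / d ^+ 2) <= d * n%:R / 8 ->
  (1 - d / 2) ^+ n * (2 / (d / 16) ^+ 2) ^+ k / (1 - d / 16) ^+ (2 * n)
  <= 1 / 2.
Proof.
move=> /andP[d0 d1] dn kd.
have le1 : (1 - d / 2) ^+ n <= expR (- (d * n%:R) / 2).
  have -> : - (d * n%:R) / 2 = n%:R * (- d / 2) by field.
  rewrite expRM_natl lerXn2r ?nnegrE ?expR_ge0//; first by lra.
  by have := expR_ge1Dx (- d / 2); lra.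
have le2 : (2 / (d / 16) ^+ 2) ^+ k <= expR (d * n%:R / 8).
  have -> : 2 / (d / 16) ^+ 2 = 2 ^+ 9 / d ^+ 2 by field; rewrite gt_eqF.
  have pos : 0 < 2 ^+ 9 / d ^+ 2 by rewrite divr_gt0 ?exprn_gt0.
  by rewrite -[X in X ^+ k]lnK ?posrE// -expRM_natl ler_expR.
have le3 : ((1 - d / 16) ^+ (2 * n))^-1 <= expR (d * n%:R / 4).
  have -> : d * n%:R / 4 = (2 * n)%:R * (d / 8) by rewrite natrM; field.
  rewrite expRM_natl -exprVn lerXn2r ?nnegrE ?expR_ge0//.
    by rewrite invr_ge0; lra.
  (* This reduces to 1/(1 - d/16) <= 1 + d/8. *)
  apply: le_trans (expR_ge1Dx _); rewrite invf_ple ?posrE; [|lra|lra].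
  by rewrite -[leLHS]mul1r ler_pdivrMr; nra.
have e1 : expR (- 1) <= 1 / 2 :> R.
  rewrite expRN div1r lef_pV2 ?posrE ?expR_gt0//.
  by have := expR_ge1Dx (1 : R); lra.
apply: le_trans e1.
apply: (@le_trans _ _ (expR (- (d * n%:R) / 2) * expR (d * n%:R / 8)
    * expR (d * n%:R / 4))).
  apply: ler_pM => //; last apply: ler_pM => //.
  - by rewrite mulr_ge0 ?exprn_ge0 ?divr_ge0 ?exprn_ge0//; lra.
  - by rewrite invr_ge0 exprn_ge0//; lra.
  - by rewrite exprn_ge0//; lra.
  - by rewrite exprn_ge0// divr_ge0// exprn_ge0//; lra.
by rewrite -!expRD ler_expR; lra.
Qed.

End Expectation.

(** The bound [d0] keeps [log2 (1 / delta n)] away from 0; [c] depends on [d0] alone. *)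
Theorem theoremB1 (R : realType) (d0 : R) (d0_01 : 0 < d0 < 1) :
  exists c : R, 0 < c /\
    forall delta : nat -> R,
      (forall n : nat, 0 < delta n < 1) ->
      (\forall n \near \oo, delta n <= d0) ->
      (fun n : nat => delta n * n%:R) @ \oo --> +oo ->
      \forall n \near \oo,
        L1avg (delta n) n <= (1 - c * (delta n / log2 (1 / delta n))) * n%:R.
Proof.
have /andP[d0_gt0 d0_lt1] := d0_01.
have ln2 : 0 < ln (2 : R) by rewrite ln_gt0// ltr1n.
have ln_512 : 0 < ln (2 ^+ 9 : R) by rewrite ln_gt0// exprn_egt1// ltr1n.
pose ell := - ln d0; have ell_gt0 : 0 < ell by rewrite oppr_gt0 ln_lt0.
(* Chosen so that ln(2^9/d^2) <= C ln(1/d) for all d <= [d0]; then [c] makes 2 c C ln 2 equal to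
   1/8. *)
pose C := ln (2 ^+ 9 : R) / ell + 2.
have C_gt0 : 0 < C by rewrite addr_gt0// divr_gt0.
pose c := (16 * ln (2 : R) * C)^-1.
have c_gt0 : 0 < c by rewrite invr_gt0 !mulr_gt0.
exists c; split=> // delta delta01 delta_le delta_n.
have delta_ge8 : \forall n \near \oo, 8 <= delta n * n%:R.
  by move/cvgryPge: delta_n; apply.
near=> n; have d01 := delta01 n.
have dd0 : delta n <= d0 by near: n.
have dn : 8 <= delta n * n%:R by near: n.
set d := delta n in d01 dd0 dn *; have /andP[d_gt0 d_lt1] := d01.
have d01' : 0 <= d <= 1 by rewrite !ltW.
have [A <-] := L1avg_attained n d01'.
pose L := - ln d.
have ell_le : ell <= L by rewrite lerN2 ler_ln ?posrE.
have L_gt0 : 0 < L by exact: lt_le_trans ell_le.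
have -> : log2 (1 / d) = L / ln 2 by rewrite /log2 div1r lnV ?posrE.
(* Twice the target deficit: a tail probability of at most 1/2 gives back at most t/2. *)
pose t := 2 * c * (d / (L / ln 2)) * n%:R.
have t_ge0 : 0 <= t.
  by rewrite mulr_ge0// ltW// !(divr_gt0, mulr_gt0).
have tC : t * ln (2 ^+ 9 / d ^+ 2) <= d * n%:R / 8.
  rewrite ln_div ?posrE ?exprn_gt0// [ln (d ^+ 2)]lnXn//.
  have -> : ln (2 ^+ 9) - ln d *+ 2 = L * (ln (2 ^+ 9) / L + 2).
    by rewrite -mulr_natr /L; field; rewrite lt_eqF// ln_lt0.
  have -> : t * (L * (ln (2 ^+ 9) / L + 2))
      = 2 * c * ln 2 * (d * n%:R) * (ln (2 ^+ 9) / L + 2).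
    by rewrite /t; field; rewrite !gt_eqF.
  have -> : d * n%:R / 8 = 2 * c * ln 2 * (d * n%:R) * C.
    by rewrite /c; field; rewrite !gt_eqF.
  rewrite ler_wpM2l//.
    by rewrite mulr_ge0 ?(le_trans _ dn)// ltW// !mulr_gt0.
  by rewrite lerD2r ler_pM2l// lef_pV2.
have l01 : 0 < d / 16 < 1 by lra.
have half : (1 - d / 2) ^+ n * (2 / (d / 16) ^+ 2) ^+ Num.truncn t
    / (1 - d / 16) ^+ (2 * n) <= 1 / 2.
  (* Passing from [t] to its integer part uses that the logarithm is nonnegative. *)
  apply: tail_le_half => //; apply: le_trans tC; rewrite ler_wpM2r//.
    rewrite ln_ge0// ler_pdivlMr ?exprn_gt0// mul1r.
    by apply: (@le_trans _ _ 1); rewrite ?exprn_ile1 ?exprn_ege1 ?ler1n// ltW.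
  by have /andP[] := truncn_itv t_ge0.
have tail := le_trans (lcs_trace_tail (Num.truncn t) A d01' l01) half.
apply: le_trans (expected_lcs_le d01' t_ge0 tail) _.
rewrite (_ : _ * n%:R = n%:R - t + t * (1 / 2))//.
by rewrite /t; move: (d / _) => q; field.
Unshelve. all: by end_near.
Qed.
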